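(* Let $\Pi$ be a finite set of proposition symbols and $I=[a]$ with $a$ a positive integer. Every class of finite pointed $(\Pi,I)$-models recognizable by a counting multichannel message passing automaton for $(\Pi,I)$ is definable by a countable disjunction of $(\Pi,I)$-formulae of graded multimodal logic. Moreover, if the automaton is recursively enumerable, then the disjunction can be taken to be recursively enumerable.
   Context: $(\Pi,I)$-formulae of graded multimodal logic are generated by $\varphi ::= \top \mid p \mid \neg\varphi \mid (\varphi\land\varphi) \mid \langle\alpha\rangle_{\geq k}\varphi$ with $p\in\Pi$, $\alpha\in I$, $k\in\mathbb N$. A $(\Pi,I)$-model is $M=(W,(R_\alpha)_{\alpha\in I},V)$ with $W$ a nonempty finite set, $R_\alpha\subseteq W\times W$, $V\colon\Pi\to\wp(W)$; a pointed model is $(M,w)$ with $w\in W$; $\mathcal N^\alpha(w)=\{v:(w,v)\in R_\alpha\}$. Semantics is standard, with $(M,w)\models\langle\alpha\rangle_{\geq k}\psi$ iff $|\{v\in\mathcal N^\alpha(w):(M,v)\models\psi\}|\geq k$. A class $\mathcal K$ of finite pointed $(\Pi,I)$-models is definable by a countable disjunction if there is a countable set $S$ of formulae with $(M,w)\in\mathcal K$ iff $(M,w)\models\varphi$ for some $\varphi\in S$, for every finite pointed $(\Pi,I)$-model; the disjunction is recursively enumerable if $S$ is. A multiset over $X$ is a function $X\to\mathbb N$; $\mathfrak m(X)$ is the set of multisets over $X$. A counting multichannel message passing automaton (CMMPA) for $(\Pi,I)$ is $A=(Q,\pi,\delta,F)$ with $Q$ a nonempty countable set of states, $\pi\colon\wp(\Pi)\to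 Q$, $\delta\colon\mathfrak m(Q)^{|I|}\times Q\to Q$, $F\subseteq Q$. On a finite model $M$, $f_0(w)=\pi(\{p\in\Pi:w\in V(p)\})$ and $f_{t+1}(w)=\delta(N_1,\dots,N_{|I|},f_t(w))$, where $N_\alpha$ is the multiset of values $f_t(v)$ for $v\in\mathcal N^\alpha(w)$. $A$ accepts $(M,w)$ if $f_t(w)\in F$ for some $t\in\mathbb N$, and $A$ recognizes $\mathcal K$ if it accepts exactly the finite pointed models in $\mathcal K$. $A$ is recursively enumerable if $F$ is recursively enumerable and $\delta$ is computable. *)

(* Defs.v *)
From mathcomp Require Import all_boot.
Set Implicit Arguments. Unset Printing Implicit Defensive.

Inductive formula (P : Type) (a : nat) : Type :=
  | FTop
  | FVar of P
  | FNeg of formula P a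
  | FAnd of formula P a & formula P a
  | FDia of 'I_a & nat & formula P a.
Arguments FTop {P a}.

(* A finite (Pi, I)-model: finite nonempty carrier (nonemptiness is automatic
   for pointed models), one relation per alpha in I, and a valuation. *)
Record model (P : finType) (a : nat) : Type := Model {
  carrier : finType;
  rel_of : 'I_a -> rel carrier;
  valu : P -> pred carrier }.

Fixpoint sat (P : finType) (a : nat) (M : model P a) (w : carrier M)
    (phi : formula P a) {struct phi} : bool :=
  match phi with
  | FTop => true
  | FVar p => valu M p w
  | FNeg psi => ~~ sat M w psi
  | FAnd psi chi => sat M w psi && sat M w chi
  | FDia al k psi =>
      k <= #|[pred v | rel_of M al w v && sat M v psi]|
  end.

Definition pclass (P : finType) (a : nat) := forall M : model P a, carrier M -> Prop.

(* K is defined by the (countable: the formula type is countable) disjunction S *)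
Definition defines (P : finType) (a : nat) (S : formula P a -> Prop) (K : pclass P a) :=
  forall (M : model P a) (w : carrier M), K M w <-> exists2 phi, S phi & sat M w phi.

(* Multisets over Q are functions Q -> nat. *)
Record cmmpa (P : finType) (a : nat) : Type := CMMPA {
  state : countType;
  pi_of : {set P} -> state;
  delta : ('I_a -> state -> nat) -> state -> state;
  final : state -> Prop }.

Fixpoint run (P : finType) (a : nat) (A : cmmpa P a) (M : model P a) (t : nat)
    (w : carrier M) : state A :=
  match t with
  | 0 => pi_of A [set p | valu M p w]
  | t'.+1 => delta A (fun al q => #|[pred v | rel_of M al w v && (run A M t' v == q)]|)
                     (run A M t' w)
  end.

Definition accepts (P : finType) (a : nat) (A : cmmpa P a) (M : model P a) (w : carrier M) :=
  exists t, final A (run A M t w).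

Definition recognizes (P : finType) (a : nat) (A : cmmpa P a) (K : pclass P a) :=
  forall (M : model P a) (w : carrier M), K M w <-> accepts A M w.

Definition cpair (x y : nat) : nat := ((x + y) * (x + y).+1)./2 + y.

Fixpoint unpair (n : nat) : nat * nat :=
  match n with
  | 0 => (0, 0)
  | n'.+1 => let: (x, y) := unpair n' in
             if x is x'.+1 then (x', y.+1) else (y.+1, 0)
  end.

Inductive prcode : Type :=
  | PZero | PSucc | PFst | PSnd
  | PComp of prcode & prcode
  | PPair of prcode & prcode
  | PRec of prcode & prcode
  | PMu of prcode.

Inductive peval : prcode -> nat -> nat -> Prop :=
  | ev_zero x : peval PZero x 0
  | ev_succ x : peval PSucc x x.+1
  | ev_fst x : peval PFst x (unpair x).1
  | ev_snd x : peval PSnd x (unpair x).2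
  | ev_comp f g x y z : peval g x y -> peval f y z -> peval (PComp f g) x z
  | ev_pair f g x y1 y2 : peval f x y1 -> peval g x y2 -> peval (PPair f g) x (cpair y1 y2)
  | ev_rec0 f g x r : peval f x r -> peval (PRec f g) (cpair x 0) r
  | ev_recS f g x k r s : peval (PRec f g) (cpair x k) r ->
      peval g (cpair x (cpair k r)) s -> peval (PRec f g) (cpair x k.+1) s
  | ev_mu f x n : peval f (cpair x n) 0 ->
      (forall m, m < n -> exists2 v, v != 0 & peval f (cpair x m) v) ->
      peval (PMu f) x n.

Definition re_set (X : nat -> Prop) : Prop :=
  exists c : prcode, forall n, X n <-> exists m, peval c n m.

Fixpoint code_list (s : seq nat) : nat :=
  if s is x :: s' then (cpair x (code_list s')).+1 else 0.

Fixpoint code_formula (P : finType) (a : nat) (phi : formula P a) {struct phi} : nat :=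
  match phi with
  | FTop => cpair 0 0
  | FVar p => cpair 1 (enum_rank p)
  | FNeg psi => cpair 2 (@code_formula P a psi)
  | FAnd psi chi => cpair 3 (cpair (@code_formula P a psi) (@code_formula P a chi))
  | FDia al k psi => cpair 4 (cpair al (cpair k (@code_formula P a psi)))
  end.
Arguments code_formula {P a} phi.

Definition re_formulas (P : finType) (a : nat) (S : formula P a -> Prop) : Prop :=
  re_set (fun n => exists2 phi, S phi & code_formula phi = n).

(* States are coded via the countType encoding [pickle]; a finite multiset
   over Q is presented by any list enumerating it with multiplicities. *)
Definition computable_delta (P : finType) (a : nat) (A : cmmpa P a) : Prop :=
  exists c : prcode, forall (ls : 'I_a -> seq (state A)) (q : state A),
    peval c (cpair (code_list [seq code_list (map pickle (ls i)) | i <- enum 'I_a])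
                   (pickle q))
          (pickle (delta A (fun i q' => count_mem q' (ls i)) q)).

Definition re_automaton (P : finType) (a : nat) (A : cmmpa P a) : Prop :=
  re_set (fun n => exists2 q, final A q & pickle q = n) /\ computable_delta A.

Arguments sat {P a} M w phi.
Arguments defines {P a} S K.
Arguments run {P a} A M t w.
Arguments accepts {P a} A M w.
Arguments recognizes {P a} A K.
Arguments re_formulas {P a} S.
Arguments computable_delta {P a} A.
Arguments re_automaton {P a} A.

(* Main.v *)
(** From finitely many formulae [f_j] entailing that the state after [t] rounds is
    [q_j], one builds a formula fixing, for each relation, the multiset of states of
    the successors: it bounds the number of successors and bounds from below the
    number of successors satisfying the disjunction of the [f_j] with [q_j = q].
    Such a formula determines the state after [t.+1] rounds, and doing this for all
    worlds of a finite model at once yields a formula true at a given world and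
    entailing the state reached there. The disjunction consists of these formulae
    for the accepted models, each conjoined with a tautology whose counting
    threshold encodes the model, the round and the world it was built from. *)
Require Import Defs.
From mathcomp Require Import all_boot.
From mathcomp Require Import zify.
From Stdlib Require Import FunctionalExtensionality.
Set Implicit Arguments. Unset Strict Implicit. Unset Printing Implicit Defensive.

(** * Evaluation of codes *)

(** With [cpairS0], this mirrors the two clauses of [unpair]: a step along an antidiagonal and the
    jump to the next one. *)
Lemma cpairSS x y : cpair x y.+1 = (cpair x.+1 y).+1.
Proof. by rewrite /cpair addSnnS addnS. Qed.

Lemma cpairS0 x : cpair x.+1 0 = (cpair 0 x).+1.
Proof.
rewrite /cpair !addn0 !add0n.
have -> : x.+1 * x.+2 = x * x.+1 + x.+1.*2 by lia.
lia.
Qed.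

Lemma unpair_cpairK n : cpair (unpair n).1 (unpair n).2 = n.
Proof.
elim: n => // n; rewrite [unpair n.+1]/=; case: (unpair n) => -[|x] y /= <-.
- by rewrite cpairS0.
- by rewrite cpairSS.
Qed.

Lemma cpairK x y : unpair (cpair x y) = (x, y).
Proof.
(* The induction is on the value of the code: a step back in the enumeration may increase either
   coordinate. *)
have [n] := ubnP (cpair x y); elim: n x y => // n IHn x [|y].
- case: x => // x; rewrite cpairS0 ltnS => /IHn /= -> //.
- by rewrite cpairSS ltnS => /IHn /= ->.
Qed.

Lemma cpair_inj x y x' y' : cpair x y = cpair x' y' -> x = x' /\ y = y'.
Proof. by move=> E; have := cpairK x y; rewrite E cpairK => -[-> ->]. Qed.

Lemma leq_cpairr x y : y <= cpair x y.
Proof. exact: leq_addl. Qed.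

(** The argument of a recursion stays behind an equation because [cpair] is a function, not a
    constructor. *)
Lemma peval_inv c x z : peval c x z ->
  match c with
  | PZero => z = 0
  | PSucc => z = x.+1
  | PFst => z = (unpair x).1
  | PSnd => z = (unpair x).2
  | PComp f g => exists2 y, peval g x y & peval f y z
  | PPair f g => exists y1 y2, [/\ peval f x y1, peval g x y2 & z = cpair y1 y2]
  | PRec f g => exists x' k, x = cpair x' k /\
      if k is k'.+1 then
        exists2 r, peval (PRec f g) (cpair x' k') r &
                   peval g (cpair x' (cpair k' r)) z
      else peval f x' z
  | PMu f => peval f (cpair x z) 0 /\
      forall m, m < z -> exists2 v, v != 0 & peval f (cpair x m) v
  end.
Proof.
case=> //.
- by move=> f g x0 y z0 Hg Hf; exists y.
- by move=> f g x0 y1 y2 Hf Hg; exists y1, y2.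
- by move=> f g x0 r Hf; exists x0, 0.
- by move=> f g x0 k r s Hr Hs; exists x0, k.+1; split=> //; exists r.
Qed.

Lemma peval_det c x y z : peval c x y -> peval c x z -> y = z.
Proof.
elim: c x y z => [||||f IHf g IHg|f IHf g IHg|f IHf g IHg|f IHf] x y z;
  try by move=> /peval_inv-> /peval_inv->.
- by move=> /peval_inv[u gu fu] /peval_inv[v /(IHg _ _ _ gu) <- /(IHf _ _ _ fu)].
- move=> /peval_inv[u [v [fu gv ->]]] /peval_inv[u' [v' [fu' gv' ->]]].
  by rewrite (IHf _ _ _ fu fu') (IHg _ _ _ gv gv').
- case/peval_inv=> [x' [k [-> Hy]]] /peval_inv[_ [_ [/cpair_inj[<- <-]]]].
  elim: k y z Hy => [|k IHk] y z; first exact: IHf.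
  case=> r Hr Hy [r' Hr' Hz]; suff e : r = r' by apply: IHg Hy _; rewrite e.
  have [x1 [_ [/cpair_inj[<- <-] Hr1]]] := peval_inv Hr.
  have [x2 [_ [/cpair_inj[<- <-] Hr2]]] := peval_inv Hr'.
  exact: IHk Hr1 Hr2.
- move=> /peval_inv[y0 lty] /peval_inv[z0 ltz].
  (* If the two minima differed, the body would take both a zero and a nonzero value at the smaller
     one. *)
  case: (ltngtP y z) => // [/ltz|/lty] [v v0 Hv].
  + by rewrite (IHf _ _ _ y0 Hv) eqxx in v0.
  + by rewrite (IHf _ _ _ z0 Hv) eqxx in v0.
Qed.

(** * Computable functions between encoded types *)

(* [Encodable] types carry their numbering, so that computability of functions
   between them never has to account for junk codes. *)
Class Encodable (T : Type) := enc : T -> nat.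
#[export] Hint Mode Encodable ! : typeclass_instances.

#[export] Instance enc_nat : Encodable nat := id.
#[export] Instance enc_bool : Encodable bool := nat_of_bool.
#[export] Instance enc_pair T U {eT : Encodable T} {eU : Encodable U} :
  Encodable (T * U) := fun p => cpair (enc p.1) (enc p.2).
#[export] Instance enc_seq T {eT : Encodable T} : Encodable (seq T) :=
  fun s => code_list (map enc s).
#[export] Instance enc_formula (P : finType) a : Encodable (formula P a) :=
  code_formula.

Definition computable X Y {eX : Encodable X} {eY : Encodable Y} (f : X -> Y) :=
  exists c, forall x, peval c (enc x) (enc (f x)).

Lemma unpair_enc T U {eT : Encodable T} {eU : Encodable U} (p : T * U) :
  unpair (enc p) = (enc p.1, enc p.2).
Proof. exact: cpairK. Qed.

(** Only codes matter, so a computation may be carried out in another result type and transferred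
    back. *)
Lemma computable_code X Y Z {eX : Encodable X} {eY : Encodable Y}
    {eZ : Encodable Z} (f : X -> Y) (g : X -> Z) :
  computable f -> (forall x, enc (f x) = enc (g x)) -> computable g.
Proof. by move=> [c Hc] fg; exists c => x; rewrite -fg. Qed.

(** Every number is a pair, so the identity is obtained by taking it apart and pairing it again. *)
Lemma computable_id X {eX : Encodable X} : computable (fun x : X => x).
Proof.
exists (PPair PFst PSnd) => x; rewrite -[X in peval _ _ X]unpair_cpairK.
exact: ev_pair (ev_fst _) (ev_snd _).
Qed.

Lemma computable_comp X Y Z {eX : Encodable X} {eY : Encodable Y}
    {eZ : Encodable Z} (g : Y -> Z) (f : X -> Y) :
  computable g -> computable f -> computable (fun x => g (f x)).
Proof.
by move=> [c Hc] [d Hd]; exists (PComp c d) => x; apply: ev_comp (Hd x) (Hc _).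
Qed.

Lemma computable_pair X Y Z {eX : Encodable X} {eY : Encodable Y}
    {eZ : Encodable Z} (f : X -> Y) (g : X -> Z) :
  computable f -> computable g -> computable (fun x => (f x, g x)).
Proof.
by move=> [c Hc] [d Hd]; exists (PPair c d) => x; apply: ev_pair (Hc x) (Hd x).
Qed.

Lemma computable_fst X Y Z {eX : Encodable X} {eY : Encodable Y}
    {eZ : Encodable Z} (f : X -> Y * Z) :
  computable f -> computable (fun x => (f x).1).
Proof.
move=> [c Hc]; exists (PComp PFst c) => x; apply: ev_comp (Hc x) _.
have -> : enc (f x).1 = (unpair (enc (f x))).1 by rewrite unpair_enc.
exact: ev_fst.
Qed.

Lemma computable_snd X Y Z {eX : Encodable X} {eY : Encodable Y}
    {eZ : Encodable Z} (f : X -> Y * Z) :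
  computable f -> computable (fun x => (f x).2).
Proof.
move=> [c Hc]; exists (PComp PSnd c) => x; apply: ev_comp (Hc x) _.
have -> : enc (f x).2 = (unpair (enc (f x))).2 by rewrite unpair_enc.
exact: ev_snd.
Qed.

Lemma computable_succ X {eX : Encodable X} (f : X -> nat) :
  computable f -> computable (fun x => (f x).+1).
Proof.
by move=> [c Hc]; exists (PComp PSucc c) => x; apply: ev_comp (Hc x) (ev_succ _).
Qed.

Lemma computable_cst X Y {eX : Encodable X} {eY : Encodable Y} (y : Y) :
  computable (fun _ : X => y).
Proof.
have [c Hc] : exists c, forall x, peval c x (enc y).
  elim: (enc y) => [|n [c Hc]]; first by exists PZero => x; apply: ev_zero.
  by exists (PComp PSucc c) => x; apply: ev_comp (Hc x) (ev_succ _).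
by exists c => x.
Qed.

(** * Bounded iteration, tests and arithmetic *)

Lemma computable_iteri X Y {eX : Encodable X} {eY : Encodable Y}
    (n : X -> nat) (g : X -> nat -> Y -> Y) (z : X -> Y) :
  computable n -> computable (fun p : X * (nat * Y) => g p.1 p.2.1 p.2.2) ->
  computable z -> computable (fun x => iteri (n x) (g x) (z x)).
Proof.
move=> [cn Hn] [cg Hg] [cz Hz].
have [ci Hi] := computable_id (X := X).
exists (PComp (PRec cz cg) (PPair ci cn)) => x.
apply: ev_comp (ev_pair (Hi x) (Hn x)) _.
rewrite [enc (n x)]/enc /enc_nat; elim: (n x) => [|k IHk] /=; first exact: ev_rec0.
exact: ev_recS IHk (Hg (x, (k, _))).
Qed.

Lemma computable_iter X Y {eX : Encodable X} {eY : Encodable Y}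
    (n : X -> nat) (g : X -> Y -> Y) (z : X -> Y) :
  computable n -> computable (fun p : X * Y => g p.1 p.2) ->
  computable z -> computable (fun x => iter (n x) (g x) (z x)).
Proof.
move=> Hn Hg Hz.
have H : computable (fun x => iteri (n x) (fun _ => g x) (z x)).
  apply: computable_iteri => //.
  apply: (computable_comp (g := fun p : X * Y => g p.1 p.2)
    (f := fun p => (p.1, p.2.2))) => //.
  apply: computable_pair; first exact/computable_fst/computable_id.
  exact/computable_snd/computable_snd/computable_id.
by apply: computable_code H _ => x; congr enc; elim: (n x) => //= k ->.
Qed.

Lemma computable_pred X {eX : Encodable X} (f : X -> nat) :
  computable f -> computable (fun x => (f x).-1).
Proof.
(* The step discards the value and returns the counter, whose last value is the predecessor. *)
move=> Hf; have H : computable (fun x => iteri (f x) (fun k _ => k) 0).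
  apply: computable_iteri Hf _ (computable_cst _).
  exact/computable_fst/computable_snd/computable_id.
by apply: computable_code H _ => x; case: (f x).
Qed.

(** A boolean is coded by 0 or 1, so a conditional is an iteration of at most one round. *)
Lemma computable_if X Y {eX : Encodable X} {eY : Encodable Y}
    (b : X -> bool) (f g : X -> Y) :
  computable b -> computable f -> computable g ->
  computable (fun x => if b x then f x else g x).
Proof.
move=> Hb Hf Hg.
have H : computable (fun x => iter (b x) (fun _ => f x) (g x)).
  apply: computable_iter => //.
  exact: computable_comp Hf (computable_fst (computable_id (X := X * Y))).
by apply: computable_code H _ => x; case: (b x).
Qed.

Lemma computable_negb X {eX : Encodable X} (b : X -> bool) :
  computable b -> computable (fun x => ~~ b x).
Proof.
by move=> Hb; apply: computable_if Hb (computable_cst _) (computable_cst _).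
Qed.

Lemma computable_sub X {eX : Encodable X} (f g : X -> nat) :
  computable f -> computable g -> computable (fun x => f x - g x).
Proof.
move=> Hf Hg; have H : computable (fun x => iter (g x) predn (f x)).
  by apply: computable_iter => //; apply/computable_pred/computable_snd/computable_id.
apply: computable_code H _ => x; congr enc.
by elim: (g x) => [|k /= ->]; rewrite ?subn0 ?subnS.
Qed.

Lemma computable_leq X {eX : Encodable X} (f g : X -> nat) :
  computable f -> computable g -> computable (fun x => f x <= g x).
Proof.
move=> Hf Hg.
have H : computable (fun x => iter (f x - g x) (fun _ => false) true).
  apply: computable_iter; [exact: computable_sub | exact: computable_cst..].
by apply: computable_code H _ => x; rewrite /leq; case: (f x - g x).
Qed.

Lemma computable_eqn X {eX : Encodable X} (f g : X -> nat) :
  computable f -> computable g -> computable (fun x => f x == g x).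
Proof.
move=> Hf Hg.
have H : computable (fun x => if f x <= g x then g x <= f x else false).
  apply: computable_if; [exact: computable_leq..|exact: computable_cst].
by apply: computable_code H _ => x; rewrite eqn_leq; case: (f x <= g x).
Qed.

(** * Lists and folds *)

Lemma computable_cons X Y {eX : Encodable X} {eY : Encodable Y}
    (f : X -> Y) (g : X -> seq Y) :
  computable f -> computable g -> computable (fun x => f x :: g x).
Proof.
move=> Hf Hg; have H : computable (fun x => (enc (f x, g x)).+1).
  by apply: computable_succ; apply: computable_code (computable_pair Hf Hg) _.
exact: computable_code H _.
Qed.

(** The pair [unpair n] has the code [n]: the type changes, the code does not. *)
Lemma computable_unpair X {eX : Encodable X} (f : X -> nat) :
  computable f -> computable (fun x => unpair (f x)).
Proof.
move=> Hf; apply: computable_code Hf _ => x.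
by rewrite /(enc (unpair _)) /enc_pair unpair_cpairK.
Qed.

Lemma computable_enc X Y {eX : Encodable X} {eY : Encodable Y} (f : X -> Y) :
  computable f -> computable (fun x => enc (f x)).
Proof. by move=> Hf; apply: computable_code Hf _. Qed.

Lemma computable_nilp X Y {eX : Encodable X} {eY : Encodable Y} (s : X -> seq Y) :
  computable s -> computable (fun x => nilp (s x)).
Proof.
move=> Hs; apply: computable_code (computable_eqn (computable_enc Hs) (computable_cst 0)) _.
by move=> x; case: (s x).
Qed.

Lemma computable_head X Y {eX : Encodable X} {eY : Encodable Y} d (s : X -> seq Y) :
  computable s -> computable (fun x => head d (s x)).
Proof.
move=> Hs.
have H : computable (fun x => if nilp (s x) then enc d else (unpair (enc (s x)).-1).1).
  apply: computable_if; [exact: computable_nilp | exact: computable_cst |].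
  exact/computable_fst/computable_unpair/computable_pred/computable_enc.
by apply: computable_code H _ => x; case: (s x) => //= y t; rewrite cpairK.
Qed.

Lemma computable_behead X Y {eX : Encodable X} {eY : Encodable Y} (s : X -> seq Y) :
  computable s -> computable (fun x => behead (s x)).
Proof.
move=> Hs; have H : computable (fun x => (unpair (enc (s x)).-1).2).
  exact/computable_snd/computable_unpair/computable_pred/computable_enc.
by apply: computable_code H _ => x; case: (s x) => //= y t; rewrite cpairK.
Qed.

Lemma computable_nth X Y {eX : Encodable X} {eY : Encodable Y} d
    (s : X -> seq Y) (n : X -> nat) :
  computable s -> computable n -> computable (fun x => nth d (s x) (n x)).
Proof.
move=> Hs Hn; have H : computable (fun x => head d (iter (n x) behead (s x))).
  apply/computable_head/computable_iter => //.
  exact/computable_behead/computable_snd/computable_id.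
apply: computable_code H _ => x; congr enc.
by elim: (n x) (s x) => [|k IHk] [|y t] //; rewrite iterSr ?IHk //= nth_nil.
Qed.

(** Supplies a computable bound on the number of rounds needed to run through a list. *)
Lemma leq_size_enc Y {eY : Encodable Y} (s : seq Y) : size s <= enc s.
Proof.
by elim: s => //= y s IHs; rewrite ltnS (leq_trans IHs) ?leq_cpairr.
Qed.

(** The fold is an iteration on the remaining list and the accumulator. The code of the list bounds
    its length, and the surplus rounds change nothing. *)
Lemma computable_foldl X Y Z {eX : Encodable X} {eY : Encodable Y}
    {eZ : Encodable Z} (d : Y) (g : X -> Z -> Y -> Z) (z : X -> Z) (s : X -> seq Y) :
  computable (fun p : X * (Z * Y) => g p.1 p.2.1 p.2.2) ->
  computable z -> computable s -> computable (fun x => foldl (g x) (z x) (s x)).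
Proof.
move=> Hg Hz Hs.
pose step x (p : seq Y * Z) :=
  (behead p.1, if nilp p.1 then p.2 else g x p.2 (head d p.1)).
have H : computable (fun x => (iter (enc (s x)) (step x) (s x, z x)).2).
  apply/computable_snd/computable_iter; last exact: computable_pair.
  - exact: computable_enc.
  - have c1 : computable (fun p : X * (seq Y * Z) => p.2.1).
      exact/computable_fst/computable_snd/computable_id.
    have c2 : computable (fun p : X * (seq Y * Z) => p.2.2).
      exact/computable_snd/computable_snd/computable_id.
    apply: computable_pair; first exact: computable_behead.
    apply: computable_if (c2) _; first exact: computable_nilp.
    apply: (computable_comp (f := fun p => (p.1, (p.2.2, head d p.2.1))) Hg).
    apply: computable_pair; first exact/computable_fst/computable_id.
    by apply: computable_pair => //; apply: computable_head.
apply: computable_code H _ => x; congr enc.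
have /= := @leq_size_enc _ eY (s x).
elim: (s x) (enc (s x)) (z x) => [|y t IHt] n.
  by move=> c _; elim: n => // n; rewrite iterSr.
by case: n => // n c lt_n; rewrite iterSr IHt.
Qed.

Lemma computable_rev X Y {eX : Encodable X} {eY : Encodable Y} (d : Y) (s : X -> seq Y) :
  computable s -> computable (fun x => rev (s x)).
Proof.
move=> Hs.
have H : computable (fun x => foldl (fun t y => y :: t) [::] (s x)).
  apply: (computable_foldl d) => //; last exact: computable_cst.
  apply: computable_cons; first exact/computable_snd/computable_snd/computable_id.
  exact/computable_fst/computable_snd/computable_id.
apply: computable_code H _ => x; congr enc.
by rewrite -[rev _]cats0 -catrevE; elim: (s x) [::] => //= y t IHt r; rewrite IHt.
Qed.

Lemma computable_foldr X Y Z {eX : Encodable X} {eY : Encodable Y}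
    {eZ : Encodable Z} (d : Y) (g : X -> Y -> Z -> Z) (z : X -> Z) (s : X -> seq Y) :
  computable (fun p : X * (Y * Z) => g p.1 p.2.1 p.2.2) ->
  computable z -> computable s -> computable (fun x => foldr (g x) (z x) (s x)).
Proof.
move=> Hg Hz Hs.
have H : computable (fun x => foldl (fun r y => g x y r) (z x) (rev (s x))).
  apply: (computable_foldl d) => //; last exact: computable_rev.
  apply: (computable_comp (f := fun p : X * (Z * Y) => (p.1, (p.2.2, p.2.1))) Hg).
  apply: computable_pair; first exact/computable_fst/computable_id.
  apply: computable_pair; first exact/computable_snd/computable_snd/computable_id.
  exact/computable_fst/computable_snd/computable_id.
by apply: computable_code H _ => x; rewrite foldl_rev.
Qed.

Lemma computable_map X Y Z {eX : Encodable X} {eY : Encodable Y}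
    {eZ : Encodable Z} (d : Y) (g : X -> Y -> Z) (s : X -> seq Y) :
  computable (fun p : X * Y => g p.1 p.2) -> computable s ->
  computable (fun x => [seq g x y | y <- s x]).
Proof.
move=> Hg Hs; apply: (computable_foldr d (g := fun x y t => g x y :: t)) => //.
  apply: computable_cons; last exact/computable_snd/computable_snd/computable_id.
  apply: (computable_comp (f := fun p : X * (Y * seq Z) => (p.1, p.2.1)) Hg).
  apply: computable_pair; first exact/computable_fst/computable_id.
  exact/computable_fst/computable_snd/computable_id.
exact: computable_cst.
Qed.

Lemma computable_size X Y {eX : Encodable X} {eY : Encodable Y} (d : Y) (s : X -> seq Y) :
  computable s -> computable (fun x => size (s x)).
Proof.
move=> Hs; apply: (computable_foldr d (g := fun _ _ n => n.+1)) => //.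
  exact/computable_succ/computable_snd/computable_snd/computable_id.
exact: computable_cst.
Qed.

Lemma computable_eq X (Y : eqType) {eX : Encodable X} {eY : Encodable Y} (f g : X -> Y) :
  injective (enc : Y -> nat) ->
  computable f -> computable g -> computable (fun x => f x == g x).
Proof.
move=> injY Hf Hg.
apply: computable_code (computable_eqn (computable_enc Hf) (computable_enc Hg)) _.
by move=> x; rewrite (inj_eq injY).
Qed.

Lemma computable_count_mem X (Y : eqType) {eX : Encodable X} {eY : Encodable Y} (d : Y)
    (y : X -> Y) (s : X -> seq Y) :
  injective (enc : Y -> nat) ->
  computable y -> computable s -> computable (fun x => count_mem (y x) (s x)).
Proof.
move=> injY Hy Hs.
have H : computable (fun x => foldr (fun u n => if u == y x then n.+1 else n) 0 (s x)).
  have c2 : computable (fun p : X * (Y * nat) => p.2.2).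
    exact/computable_snd/computable_snd/computable_id.
  apply: (computable_foldr d) => //; last exact: computable_cst.
  apply: computable_if => //; last exact: computable_succ.
  apply: computable_eq => //; first exact/computable_fst/computable_snd/computable_id.
  by apply: computable_comp Hy _; apply/computable_fst/computable_id.
apply: computable_code H _ => x; congr enc.
by elim: (s x) => //= u t ->; case: (u == y x).
Qed.

(** The index list is fixed, so indices need no coding and each may come with its own program. *)
Lemma computable_tabulate X Y (I : Type) {eX : Encodable X} {eY : Encodable Y}
    (g : X -> I -> Y) (s : seq I) :
  (forall i, computable (fun x => g x i)) -> computable (fun x => [seq g x i | i <- s]).
Proof.
move=> Hg; elim: s => [|i s IHs]; first exact: computable_cst.
exact: computable_cons.
Qed.

(** * Injective and surjective codings *)

Lemma enc_pair_inj T U {eT : Encodable T} {eU : Encodable U} :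
  injective (enc : T -> nat) -> injective (enc : U -> nat) ->
  injective (enc : T * U -> nat).
Proof. by move=> iT iU [x y] [x' y'] /cpair_inj[/iT /= -> /iU /= ->]. Qed.

Lemma enc_seq_inj T {eT : Encodable T} :
  injective (enc : T -> nat) -> injective (enc : seq T -> nat).
Proof.
move=> iT; elim=> [|x s IHs] [|y t] //= [] /cpair_inj[/iT -> est].
by rewrite (IHs _ est).
Qed.

Definition enc_surj T {eT : Encodable T} := forall n, exists x : T, enc x = n.

Lemma enc_pair_surj T U {eT : Encodable T} {eU : Encodable U} :
  @enc_surj T _ -> @enc_surj U _ -> @enc_surj (T * U) _.
Proof.
move=> sT sU n; have [x ex] := sT (unpair n).1; have [y ey] := sU (unpair n).2.
by exists (x, y); rewrite /enc /enc_pair ex ey unpair_cpairK.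
Qed.

Lemma enc_seq_surj T {eT : Encodable T} : @enc_surj T _ -> @enc_surj (seq T) _.
Proof.
move=> sT n; elim/ltn_ind: n => -[|n] IHn; first by exists [::].
have [x ex] := sT (unpair n).1.
(* The tail of a list coded by [n.+1] has a code at most [n]. *)
have [|s es] := IHn (unpair n).2; first by rewrite ltnS -{2}[n]unpair_cpairK leq_cpairr.
exists (x :: s); rewrite -[n]unpair_cpairK -ex -es //.
Qed.

(** * Formulae determining the state of an automaton *)

Definition bigand P a (fs : seq (formula P a)) : formula P a := foldr (@FAnd P a) FTop fs.

(** The threshold [k.+1] is never 0, so the diamond over falsity fails everywhere and [k] is free to
    carry data. *)
Definition taut P a (al : 'I_a) k : formula P a := FNeg (FDia al k.+1 (FNeg FTop)).

Lemma sat_bigand (P : finType) a (M : model P a) w fs :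
  sat M w (bigand fs) = all (sat M w) fs.
Proof. by elim: fs => //= f fs ->. Qed.

Lemma sat_and (P : finType) a (M : model P a) w f g :
  sat M w (FAnd f g) = sat M w f && sat M w g.
Proof. by []. Qed.

Lemma sat_taut (P : finType) a (M : model P a) w al k : sat M w (taut P al k).
Proof.
rewrite /= -leqNgt eq_card0 // => v; by rewrite !inE andbF.
Qed.

(** Turns the successor counts of a run into multiplicities in a list, where subsequences and
    permutations can be used. *)
Lemma card_count_mem (W : finType) (Q : eqType) (R : pred W) (g : W -> Q) q :
  #|[pred v | R v && (g v == q)]| = count_mem q [seq g v | v <- enum R].
Proof.
rewrite cardE /enum_mem !size_filter count_map count_filter.
by apply: eq_count => v; rewrite /= !inE andbC.
Qed.

(** A formula with the state it is meant to force, as made precise by [sound]. *)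
Definition entry P a (A : cmmpa P a) := (formula P a * state A)%type.

(** The formula is unsatisfiable, so an out-of-range lookup is sound at every round. *)
Definition dflt (P : finType) a (A : cmmpa P a) : entry A := (FNeg FTop, Defs.pi_of A set0).

Definition val_formula (P : finType) a (X : {set P}) : formula P a :=
  bigand [seq if p \in X then FVar a p else FNeg (FVar a p) | p <- enum P].

Definition base_entries (P : finType) a (A : cmmpa P a) : seq (entry A) :=
  [seq (val_formula a X, Defs.pi_of A X) | X <- enum {set P}].

(** A disjunction in De Morgan form over the entries with state [q]; other entries contribute the
    neutral [FTop]. *)
Definition some_entry P a (A : cmmpa P a) (q : state A) (l : seq (entry A)) : formula P a :=
  FNeg (bigand [seq if e.2 == q then FNeg e.1 else FTop | e <- l]).

Definition counts P a (A : cmmpa P a) (al : 'I_a) (l : seq (entry A)) : formula P a :=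
  FAnd (FNeg (FDia al (size l).+1 FTop))
       (bigand [seq FDia al (count_mem e.2 [seq x.2 | x <- l]) (some_entry e.2 l)
               | e <- l]).

Definition neighbours (P : finType) a (A : cmmpa P a) (T : seq (entry A))
    (adj : seq (seq nat)) (i : 'I_a) : seq (entry A) :=
  [seq nth (dflt A) T u | u <- nth [::] adj i].

(** The first conjunct forces the current state, the others the successor multisets: together, all
    arguments of [delta]. *)
Definition next_entry (P : finType) a (A : cmmpa P a) (T : seq (entry A))
    (x : nat * seq (seq nat)) : entry A :=
  (FAnd (nth (dflt A) T x.1).1
        (bigand [seq counts i (neighbours T x.2 i) | i <- enum 'I_a]),
   delta A (fun i q => count_mem q [seq e.2 | e <- neighbours T x.2 i])
           (nth (dflt A) T x.1).2).

(* A certificate [(b, r, (t, w))] describes a model on an initial segment of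
   [nat]: [b] lists the indices of the valuations of the worlds, [r] gives for
   each world its own index and its adjacency lists; [t] is the number of rounds
   and [w] the distinguished world. *)
Definition cert := (seq nat * seq (nat * seq (seq nat)) * (nat * nat))%type.

Definition table (P : finType) a (A : cmmpa P a) (c : cert) : seq (entry A) :=
  iter c.2.1 (fun T => [seq next_entry T x | x <- c.1.2])
       [seq nth (dflt A) (base_entries A) j | j <- c.1.1].

Definition outcome (P : finType) a (A : cmmpa P a) (c : cert) : entry A :=
  nth (dflt A) (table A c) c.2.2.

(** * Soundness: the formulae force the states *)

Definition sound (P : finType) a (A : cmmpa P a) t (e : entry A) :=
  forall (M : model P a) w, sat M w e.1 -> run A M t w = e.2.

Lemma sound_dflt (P : finType) a (A : cmmpa P a) t : sound t (dflt A).
Proof. by []. Qed.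

Lemma sat_val_formula (P : finType) a (M : model P a) w X :
  sat M w (val_formula a X) = (X == [set p | valu M p w]).
Proof.
rewrite sat_bigand all_map; apply/allP/eqP => [H|-> p _ /=].
  apply/setP => p; have := H p; rewrite mem_enum inE /= => /(_ isT).
  by case: (p \in X) => /= [->|/negbTE ->].
by rewrite inE; case: ifP => //= ->.
Qed.

Lemma sound_base (P : finType) a (A : cmmpa P a) j :
  sound 0 (nth (dflt A) (base_entries A) j).
Proof.
have [lt_j|ge_j] := ltnP j (size (base_entries A)); last first.
  by rewrite nth_default //; apply: sound_dflt.
rewrite size_map in lt_j; rewrite (nth_map set0) // => M w.
rewrite [sat _ _ _]sat_val_formula.
by move=> /eqP E; rewrite [in RHS]/= E.
Qed.

Lemma sat_some_entry (P : finType) a (A : cmmpa P a) (M : model P a) w q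
    (l : seq (entry A)) :
  sat M w (some_entry q l) = has (fun e => (e.2 == q) && sat M w e.1) l.
Proof.
rewrite [LHS]/= sat_bigand -has_predC has_map; apply: eq_has => e /=.
by case: ifP => //= _; rewrite negbK.
Qed.

Lemma sat_counts (P : finType) a (A : cmmpa P a) (M : model P a) w al
    (l : seq (entry A)) :
  sat M w (counts al l) =
  (#|rel_of M al w| <= size l) &&
  all (fun e => count_mem e.2 [seq x.2 | x <- l] <=
                #|[pred v | rel_of M al w v && sat M v (some_entry e.2 l)]|) l.
Proof.
rewrite sat_and sat_bigand all_map /= -leqNgt; congr ((_ <= _) && _).
by apply: eq_card => v; rewrite !inE andbT.
Qed.

(* Each listed state occurs at least as often as announced, and there are no more
   successors than listed states, so both multisets agree. *)
Lemma counts_sound (P : finType) a (A : cmmpa P a) t (f : nat -> entry A) us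
    (M : model P a) w al :
  (forall u, sound t (f u)) -> sat M w (counts al (map f us)) ->
  forall q, #|[pred v | rel_of M al w v && (run A M t v == q)]| =
            count_mem q [seq e.2 | e <- map f us].
Proof.
move=> sf; rewrite sat_counts size_map all_map => /andP[le_size /allP Hcnt] q.
rewrite card_count_mem.
set s1 := [seq run A M t v | v <- _]; set s2 := [seq e.2 | e <- _].
have sz : size s1 <= size s2.
  by rewrite !size_map -cardE.
have /count_subseqP[s ss1 ps] : forall x, count_mem x s2 <= count_mem x s1.
  move=> x; have [x_s2|/count_memPn-> //] := boolP (x \in s2).
  have [e] : exists2 u, u \in us & x = (f u).2.
    by move: x_s2; rewrite /s2 -map_comp => /mapP.
  move=> /Hcnt le_x ->; apply: leq_trans le_x _; rewrite -card_count_mem.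
  apply: subset_leq_card; apply/subsetP => v; rewrite !inE => /andP[->].
  rewrite andTb sat_some_entry has_map => /hasP[u _ /=].
  by case/andP=> /eqP <- /sf ->.
(* [s2] is a permutation of a subsequence [s] of [s1], and [s1] is no longer than [s2]; hence [s] is
   all of [s1]. *)
have := size_subseq_leqif ss1; rewrite -(perm_size ps) => -[le12].
rewrite eqn_leq le12 sz => /esym/eqP es; move: ps; rewrite es.
by move=> /permP/(_ (pred1 q)).
Qed.

Lemma sound_next (P : finType) a (A : cmmpa P a) t (T : seq (entry A)) x :
  (forall u, sound t (nth (dflt A) T u)) -> sound t.+1 (next_entry T x).
Proof.
move=> sT M w; rewrite sat_and => /andP[Hown]; rewrite sat_bigand all_map => /allP Hcnt /=.
rewrite (sT _ _ _ Hown); congr delta.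
apply: functional_extensionality => i; apply: functional_extensionality => q.
by apply: counts_sound => //; apply: Hcnt; rewrite mem_enum.
Qed.

(** Certificates need not be well formed, since every bad index falls back on [dflt]; no validity
    test is required later. *)
Lemma sound_outcome (P : finType) a (A : cmmpa P a) c : sound c.2.1 (outcome A c).
Proof.
rewrite /outcome /table; move: (c.2.2); elim: c.2.1 => [|t IHt] w /=.
  have [lt_w|ge_w] := ltnP w (size c.1.1).
    by rewrite (nth_map 0) //; apply: sound_base.
  by rewrite nth_default ?size_map //; apply: sound_dflt.
have [lt_w|ge_w] := ltnP w (size c.1.2).
  by rewrite (nth_map (0, [::])) //; apply: sound_next.
by rewrite nth_default ?size_map //; apply: sound_dflt.
Qed.

(** * Completeness: every run is described by a certificate *)

Definition model_cert (P : finType) a (M : model P a) t (w : carrier M) : cert :=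
  let idx v := index v (enum (carrier M)) in
  (([seq index [set p | valu M p v] (enum {set P}) | v <- enum (carrier M)],
    [seq (idx v, [seq [seq idx u | u <- enum (rel_of M i v)] | i <- enum 'I_a])
    | v <- enum (carrier M)]),
   (t, idx w)).

(** A successor satisfies its own entry, hence the disjunction for its state, so the lower bounds
    hold; the upper bound on successors is attained. *)
Lemma counts_complete (P : finType) a (A : cmmpa P a) t (M : model P a) w al
    (E : carrier M -> entry A) :
  (forall u, sat M u (E u).1 /\ (E u).2 = run A M t u) ->
  sat M w (counts al [seq E u | u <- enum (rel_of M al w)]).
Proof.
move=> HE; rewrite sat_counts size_map -cardE leqnn andTb.
rewrite all_map; apply/allP => u _; rewrite [preim _ _ _]/(_ <= _) -map_comp.
rewrite (eq_map (g := run A M t)); last by move=> v; case: (HE v).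
rewrite -card_count_mem; apply: subset_leq_card; apply/subsetP => v.
rewrite !inE => /andP[wv /eqP ev]; rewrite wv.
rewrite sat_some_entry has_map; apply/hasP.
have [sv rv] := HE v; exists v; first by rewrite mem_enum.
by apply/andP; split=> //; apply/eqP; rewrite rv.
Qed.

(** Induction on the round for all worlds at once, as the next formula at [w] involves the formulae
    of its successors. *)
Lemma outcome_complete (P : finType) a (A : cmmpa P a) t (M : model P a) w :
  sat M w (outcome A (model_cert t w)).1 /\
  (outcome A (model_cert t w)).2 = run A M t w.
Proof.
(* Worlds are named by their positions in the enumeration of the carrier, so a lookup at the
   position of [v] returns the value at [v]. *)
have nth_idx (T : Type) (d : T) (g : carrier M -> T) v :
    nth d [seq g u | u <- enum (carrier M)] (index v (enum (carrier M))) = g v.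
  by rewrite (nth_map v) ?index_mem ?mem_enum // nth_index ?mem_enum.
rewrite /outcome /table /=; elim: t w => [|t IHt] w.
  rewrite /= -map_comp nth_idx /= (nth_map set0) ?index_mem ?mem_enum //.
  by rewrite nth_index ?mem_enum //= sat_val_formula.
rewrite [iter _ _ _]/= -map_comp nth_idx /=.
set T := iter _ _ _ in IHt *.
pose E u := nth (dflt A) T (index u (enum (carrier M))).
have nbE i : neighbours T [seq [seq index u (enum (carrier M)) | u <- enum (rel_of M j w)]
    | j <- enum 'I_a] i = [seq E u | u <- enum (rel_of M i w)].
  by rewrite /neighbours (nth_map i) ?size_enum_ord // nth_ord_enum -map_comp.
have [sw ew] := IHt w; split.
  rewrite sw sat_bigand all_map /=; apply/allP => i _ /=.
  by rewrite nbE; apply: (counts_complete (t := t)).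
rewrite ew; congr delta.
apply: functional_extensionality => i; apply: functional_extensionality => q.
rewrite nbE -map_comp (eq_map (g := run A M t)); last by move=> v; case: (IHt v).
by rewrite -card_count_mem.
Qed.

(** * Recursive enumerability *)

#[export] Instance enc_state (P : finType) a (A : cmmpa P a) : Encodable (state A) :=
  pickle.

Lemma enc_state_inj (P : finType) a (A : cmmpa P a) :
  injective (enc : state A -> nat).
Proof. exact: pcan_inj pickleK. Qed.

(** * Computability of the formulae and of the outcome *)

Lemma computable_neg (P : finType) a X {eX : Encodable X} (f : X -> formula P a) :
  computable f -> computable (fun x => FNeg (f x)).
Proof.
move=> Hf.
exact: computable_code (computable_pair (computable_cst 2) (computable_enc Hf)) _.
Qed.

Lemma computable_and (P : finType) a X {eX : Encodable X} (f g : X -> formula P a) :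
  computable f -> computable g -> computable (fun x => FAnd (f x) (g x)).
Proof.
move=> Hf Hg.
exact: computable_code (computable_pair (computable_cst 3) (computable_pair Hf Hg)) _.
Qed.

Lemma computable_dia (P : finType) a X {eX : Encodable X} al (k : X -> nat)
    (f : X -> formula P a) :
  computable k -> computable f -> computable (fun x => FDia al (k x) (f x)).
Proof.
move=> Hk Hf; have H : computable (fun x => (4, (al : nat, (k x, f x)))).
  by do 2 (apply: computable_pair; first exact: computable_cst); apply: computable_pair.
exact: computable_code H _.
Qed.

Lemma computable_bigand (P : finType) a X {eX : Encodable X}
    (fs : X -> seq (formula P a)) :
  computable fs -> computable (fun x => bigand (fs x)).
Proof.
move=> Hfs; apply: (computable_foldr FTop) => //; last exact: computable_cst.
apply: computable_and; first exact/computable_fst/computable_snd/computable_id.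
exact/computable_snd/computable_snd/computable_id.
Qed.

Lemma computable_some_entry (P : finType) a (A : cmmpa P a) X {eX : Encodable X}
    (q : X -> state A) (l : X -> seq (entry A)) :
  computable q -> computable l -> computable (fun x => some_entry (q x) (l x)).
Proof.
move=> Hq Hl; apply/computable_neg/computable_bigand.
apply: (computable_map (dflt A)) => //; apply: computable_if.
- apply: computable_eq; first exact: enc_state_inj.
    exact/computable_snd/computable_snd/computable_id.
  by apply: computable_comp Hq _; apply/computable_fst/computable_id.
- exact/computable_neg/computable_fst/computable_snd/computable_id.
- exact: computable_cst.
Qed.

Lemma computable_states (P : finType) a (A : cmmpa P a) X {eX : Encodable X}
    (l : X -> seq (entry A)) :
  computable l -> computable (fun x => [seq e.2 | e <- l x]).
Proof.
move=> Hl; apply: (computable_map (dflt A)) => //.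
exact/computable_snd/computable_snd/computable_id.
Qed.

Lemma computable_counts (P : finType) a (A : cmmpa P a) X {eX : Encodable X} al
    (l : X -> seq (entry A)) :
  computable l -> computable (fun x => counts al (l x)).
Proof.
move=> Hl; apply: computable_and.
  apply/computable_neg/computable_dia; last exact: computable_cst.
  exact/computable_succ/(computable_size (dflt A)).
apply/computable_bigand/(computable_map (dflt A)) => //.
have Hq : computable (fun p : X * entry A => p.2.2).
  exact/computable_snd/computable_snd/computable_id.
have Hl1 : computable (fun p : X * entry A => l p.1).
  by apply: computable_comp Hl _; apply/computable_fst/computable_id.
apply: computable_dia; last exact: computable_some_entry.
apply: (computable_count_mem (Defs.pi_of A set0)) => //; first exact: enc_state_inj.
exact: computable_states.
Qed.

Lemma computable_neighbours (P : finType) a (A : cmmpa P a) X {eX : Encodable X}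
    (T : X -> seq (entry A)) (adj : X -> seq (seq nat)) i :
  computable T -> computable adj -> computable (fun x => neighbours (T x) (adj x) i).
Proof.
move=> HT Hadj; apply: (computable_map 0); last first.
  by apply: computable_nth => //; apply: computable_cst.
apply: computable_nth; last exact/computable_snd/computable_id.
by apply: computable_comp HT _; apply/computable_fst/computable_id.
Qed.

(** The program for [delta] reads multisets presented by lists, so it composes with any computable
    family of lists of states. *)
Lemma computable_delta_comp (P : finType) a (A : cmmpa P a) X {eX : Encodable X}
    (ls : X -> 'I_a -> seq (state A)) (q : X -> state A) :
  computable_delta A -> (forall i, computable (fun x => ls x i)) -> computable q ->
  computable (fun x => delta A (fun i q' => count_mem q' (ls x i)) (q x)).
Proof.
move=> [d Hd] Hls Hq.
have [c Hc] : computable (fun x => ([seq ls x i | i <- enum 'I_a], q x)).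
  by apply: computable_pair => //; apply: computable_tabulate.
exists (PComp d c) => x; apply: ev_comp (Hc x) _.
have := Hd (ls x) (q x); congr (peval d (cpair (code_list _) _) _).
by rewrite -[RHS]map_comp.
Qed.

Lemma computable_next_entry (P : finType) a (A : cmmpa P a) X {eX : Encodable X}
    (T : X -> seq (entry A)) (y : X -> nat * seq (seq nat)) :
  computable_delta A -> computable T -> computable y ->
  computable (fun x => next_entry (T x) (y x)).
Proof.
move=> Hd HT Hy.
have Hn i : computable (fun x => neighbours (T x) (y x).2 i).
  by apply: computable_neighbours => //; apply: computable_snd.
have Hown : computable (fun x => nth (dflt A) (T x) (y x).1).
  by apply: computable_nth => //; apply: computable_fst.
apply: computable_pair.
  apply: computable_and; first exact: computable_fst.
  by apply/computable_bigand/computable_tabulate => i; apply: computable_counts.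
apply: computable_delta_comp => //; last exact: computable_snd.
by move=> i; apply: computable_states.
Qed.

Lemma computable_outcome (P : finType) a (A : cmmpa P a) :
  computable_delta A -> computable (outcome A).
Proof.
move=> Hd; have Hid := computable_id (X := cert).
apply: computable_nth; last exact/computable_snd/computable_snd.
apply: computable_iter; first exact/computable_fst/computable_snd.
- apply: (computable_map (0, [::])).
    apply: computable_next_entry => //; last exact/computable_snd/computable_id.
    exact/computable_snd/computable_fst/computable_id.
  exact/computable_snd/computable_fst/computable_fst/computable_id.
- apply: (computable_map 0); last exact/computable_fst/computable_fst.
  apply: computable_nth; first exact: computable_cst.
  exact/computable_snd/computable_id.
Qed.

(** * Certificates as numbers *)

Lemma enc_cert_inj : injective (enc : cert -> nat).
Proof.
have iN : injective (enc : nat -> nat) by [].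
exact: enc_pair_inj (enc_pair_inj (enc_seq_inj iN) (enc_seq_inj
  (enc_pair_inj iN (enc_seq_inj (enc_seq_inj iN))))) (enc_pair_inj iN iN).
Qed.

Lemma enc_cert_surj n : exists c : cert, enc c == n.
Proof.
have Hn : @enc_surj nat _ by move=> k; exists k.
have [c <-] := enc_pair_surj (enc_pair_surj (enc_seq_surj Hn) (enc_seq_surj
  (enc_pair_surj Hn (enc_seq_surj (enc_seq_surj Hn))))) (enc_pair_surj Hn Hn) n.
by exists c.
Qed.

(** The total inverse of the coding, every number being the code of exactly one certificate. *)
Definition cert_of_nat n : cert := xchoose (enc_cert_surj n).

Lemma cert_of_natK n : enc (cert_of_nat n) = n.
Proof. exact/eqP/(xchooseP (enc_cert_surj n)). Qed.

Lemma encK_cert c : cert_of_nat (enc c) = c.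
Proof. by apply: enc_cert_inj; rewrite cert_of_natK. Qed.

Lemma computable_cert_of_nat : computable cert_of_nat.
Proof.
by apply: (computable_code (@computable_id nat _)) => n; rewrite cert_of_natK.
Qed.

(** * The disjunction and its enumeration *)

Definition witness (P : finType) a (al : 'I_a) (A : cmmpa P a) (c : cert) : formula P a :=
  FAnd (outcome A c).1 (taut P al (enc c)).

Definition witness_set (P : finType) a (al : 'I_a) (A : cmmpa P a) (phi : formula P a) :=
  exists2 c, final A (outcome A c).2 & phi = witness al A c.

(** An accepted model satisfies the formula of its own certificate; conversely, soundness carries
    the accepting state to every world satisfying the formula. *)
Lemma witness_set_defines (P : finType) a (al : 'I_a) (A : cmmpa P a) (K : pclass P a) :
  recognizes A K -> defines (witness_set al A) K.
Proof.
move=> HA M w; rewrite HA; split=> [[t Ft]|[_ [c Fc ->]]].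
  have [sw ew] := outcome_complete A t w.
  exists (witness al A (model_cert t w)); first by exists (model_cert t w); rewrite ?ew.
  by rewrite sat_and sw sat_taut.
by rewrite sat_and => /andP[/sound_outcome e _]; exists c.2.1; rewrite e.
Qed.

(** Five second projections pass the tag 3, the first conjunct, the tags 2 and 4 and the relation
    index. The threshold found next is one more than the code of the certificate. *)
Definition formula_cert n : cert :=
  cert_of_nat (unpair (iter 5 (fun k => (unpair k).2) n)).1.-1.

Lemma formula_cert_witness (P : finType) a (al : 'I_a) (A : cmmpa P a) c :
  formula_cert (code_formula (witness al A c)) = c.
Proof.
rewrite /formula_cert /witness; have -> f : code_formula (FAnd f (taut P al (enc c))) =
  cpair 3 (cpair (code_formula f) (cpair 2 (cpair 4 (cpair al (cpair (enc c).+1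
    (code_formula (FNeg (@FTop P a)))))))) by [].
by rewrite /iter !cpairK encK_cert.
Qed.

Lemma computable_witness (P : finType) a (al : 'I_a) (A : cmmpa P a) :
  computable_delta A -> computable (witness al A).
Proof.
move=> Hd; apply: computable_and; first exact/computable_fst/computable_outcome.
apply/computable_neg/computable_dia; last exact: computable_cst.
exact/computable_succ/(computable_enc (@computable_id cert _)).
Qed.

Lemma computable_formula_cert : computable formula_cert.
Proof.
apply: computable_comp computable_cert_of_nat _.
apply/computable_pred/computable_fst/computable_unpair.
by do !(apply/computable_snd/computable_unpair); apply: computable_id.
Qed.

(* Since a formula of [witness_set] contains its own certificate, membership is
   semi-decided without any search: recompute the formula from the certificate
   and compare, then run the enumeration of the final states on the outcome. *)
Lemma witness_set_re (P : finType) a (al : 'I_a) (A : cmmpa P a) :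
  re_automaton A -> re_formulas (witness_set al A).
Proof.
move=> [[cF HF] Hd]; pose wit n := witness al A (formula_cert n).
have Hfc := computable_formula_cert.
have [cb Hb] : computable (fun p : nat * nat => ~~ (enc (wit p.1) == p.1)).
  apply/computable_negb/computable_eqn; last exact/computable_fst/computable_id.
  apply: computable_enc; apply: (computable_comp (computable_witness al Hd)).
  by apply: computable_comp Hfc _; apply/computable_fst/computable_id.
have [cq Hq] : computable (fun n => (outcome A (formula_cert n)).2).
  by apply: computable_snd; apply: (computable_comp (computable_outcome Hd)).
(* The test [cb] ignores the searched argument, so [PMu cb] stops at 0 or never; pairing demands
   that both programs halt. *)
exists (PPair (PMu cb) (PComp cF cq)) => n; split.
- case=> _ [c Fc ->] <-; set k := code_formula _.
  have kc : formula_cert k = c by exact: formula_cert_witness.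
  have [m Hm] : exists m, peval cF (pickle (outcome A c).2) m.
    by apply/HF; exists (outcome A c).2.
  exists (cpair 0 m); apply: ev_pair; last by apply: ev_comp (Hq k) _; rewrite kc.
  by apply: ev_mu => //; have := Hb (k, 0); rewrite /= /wit kc eqxx.
- case=> _ /peval_inv[y [m [/peval_inv[Hy _] /peval_inv[q Hq' Hm] _]]].
  (* By determinacy the value 0 reached by the search is the value of the test, so [n] codes the
     recomputed formula. *)
  have wn : enc (wit n) = n.
    by have := peval_det (Hb (n, y)) Hy; case: eqP.
  have qE := peval_det Hq' (Hq n).
  have [q' Fq' /(pcan_inj pickleK) q'E] :
      exists2 q', final A q' & pickle q' = pickle (outcome A (formula_cert n)).2.
    by apply/HF; exists m; rewrite -[pickle _]qE.
  by exists (wit n) => //; exists (formula_cert n); rewrite -?q'E.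
Qed.

Theorem theorem2 (P : finType) (a : nat) (a_pos : 0 < a)
    (K : pclass P a) (A : cmmpa P a) (HA : recognizes A K) :
  (exists S : formula P a -> Prop, defines S K) /\
  (re_automaton A -> exists S : formula P a -> Prop, defines S K /\ re_formulas S).
Proof.
(* Positivity of [a] supplies a relation for the tautology that stores the certificate; one set
   serves both claims. *)
pose al := Ordinal a_pos; have Hdef := witness_set_defines al HA.
split=> [|Hre]; exists (witness_set al A) => //.
by split=> //; apply: witness_set_re.
Qed.
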